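(* For every complex number $q$ with $|q|<1$, $$\sum_{n=0}^\infty \frac{q^{n(n+1)}(q^2;q^2)_{n+1}}{(-q^3;q^3)_{n+1}(q;q)_n} = \frac{f(-q^2,-q^2)}{\varphi(-q^2)} = 1 .$$
   Context: Notation: $(a;q)_n=\prod_{j=0}^{n-1}(1-aq^j)$ (so $(a;q)_0=1$); the base may be replaced by a power of $q$. Ramanujan's theta function is $f(a,b)=\sum_{n=-\infty}^\infty a^{n(n+1)/2}b^{n(n-1)/2}$ for $|ab|<1$ (with $0^0=1$), and $\varphi(q)=f(q,q)$; $\varphi(-q^2)$ is $\varphi$ evaluated at $-q^2$. *)

(* Defs.v *)
(* Stdlib / Coquelicot; [C] is Coquelicot's field of complex numbers. *)
From Stdlib Require Import Reals ZArith.
From Coquelicot Require Import Coquelicot.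

Open Scope C_scope.

Fixpoint qpoch (a q : C) (n : nat) : C :=
  match n with
  | O => 1
  | S m => qpoch a q m * (1 - a * q ^ m)
  end.

(* Convergence of a bilateral series: the part over n >= 0 and the part over
   n <= -1 must converge separately. *)
Definition is_bilateral_series (u : Z -> C) (l : C) : Prop :=
  exists l1 l2 : C,
    is_series (fun n : nat => u (Z.of_nat n)) l1 /\
    is_series (fun n : nat => u (- Z.of_nat (S n))%Z) l2 /\
    l = l1 + l2.

(* As for [RInt], the value is meaningful only when the series converges. *)
Definition BilateralSeries (u : Z -> C) : C :=
  iota (T := C_CompleteNormedModule) (is_bilateral_series u).

(* n(n+1)/2 and n(n-1)/2 are nonnegative integers for every n in Z, so both
   [Z.div] and [Z.to_nat] are exact here; [Cpow] gives 0 ^ 0 = 1. The bilateral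
   series converges for Cmod (a * b) < 1, the domain of the theta function. *)
Definition ramanujan_f (a b : C) : C :=
  BilateralSeries (fun n : Z =>
    a ^ Z.to_nat (n * (n + 1) / 2) * b ^ Z.to_nat (n * (n - 1) / 2)).

Definition ramanujan_phi (q : C) : C := ramanujan_f q q.

(* Main.v *)
Require Import Defs.
From Stdlib Require Import Reals ZArith Lra Lia.
From Coquelicot Require Import Coquelicot.

Open Scope C_scope.

(** Since (q^2;q^2)_n = (q;q)_n (-q;q)_n, the n-th summand is
      q^(n(n+1)) (1 - q^(n+1)) (-q;q)_(n+1) / (-q^3;q^3)_(n+1).
    With U_n = q^(n(n+1)) (-q;q)_n / (-q^3;q^3)_n it equals U_n - U_(n+1)
    ([summand_telescopes]): writing y = q^(n+1), this is the identity
      (1 + y^3) - y^2 (1 + y) = (1 - y) (1 + y).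
    As U_0 = 1 and U_n tends to 0, the series sums to 1 ([telescoped_sum]).

    The quotient f(-q^2,-q^2) / phi(-q^2) is some number divided by itself, so it
    only remains to see that this number is not zero. With x = q^2 it is the
    alternating theta series, the sum of (-1)^k x^(k^2) over all integers k, which
    Gauss evaluated as the nonvanishing product (x;x)_oo / (-x;x)_oo. Only a
    lower bound is needed here, and it comes from an exact formula for partial
    sums in the manner of Shanks ([theta_partial_sum]): the sum over |k| <= n is
      (x;x)_n / (-x;x)_n
        * sum_(s <= n) (-1;x)_s / (x;x)_s * (- x^(n+1))^s.
    The first factor stays away from 0 ([qpoch_bounded], [qpoch_bounded_below]),
    and the second tends to its term at s = 0, which is 1
    ([qbinomial_sum_near_1]). Hence the limit is not 0 ([theta_series_neq_0]). *)

(** * Series and geometric estimates *)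

Lemma C_is_series_iff (u : nat -> C) (l : C) :
  is_series u l <->
  (forall eps : R, (0 < eps)%R ->
     exists N, forall n, (N <= n)%nat -> (Cmod (sum_n u n - l) < eps)%R).
Proof.
  split.
  - intros H eps He.
    destruct (proj1 (filterlim_locally_ball_norm (K := C_AbsRing)
      (U := C_NormedModule) (F := eventually) (sum_n u) l) H (mkposreal eps He))
      as [N HN].
    exists N; intros n Hn; exact (HN n Hn).
  - intros H.
    apply (proj2 (filterlim_locally_ball_norm (K := C_AbsRing)
      (U := C_NormedModule) (F := eventually) (sum_n u) l)).
    intros eps; destruct (H eps (cond_pos eps)) as [N HN].
    exists N; intros n Hn; exact (HN n Hn).
Qed.

Lemma C_sum_Sn (u : nat -> C) (n : nat) : sum_n u (S n) = sum_n u n + u (S n).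
Proof. exact (sum_Sn u n). Qed.

Lemma geometric_sum_le (r : R) (n : nat) :
  (0 <= r < 1)%R -> (sum_n (pow r) n <= / (1 - r))%R.
Proof.
  intros Hr.
  assert (H : (sum_n (pow r) n = (1 - r ^ S n) / (1 - r))%R).
  { rewrite sum_n_Reals; apply tech3; lra. }
  rewrite H.
  assert (0 <= r ^ S n)%R by (apply pow_le; lra).
  unfold Rdiv; rewrite <- (Rmult_1_l (/ (1 - r))) at 2.
  apply Rmult_le_compat_r; [left; apply Rinv_0_lt_compat|]; lra.
Qed.

Lemma pow_add_le (r : R) (m k : nat) : (0 <= r <= 1)%R -> (r ^ (m + k) <= r ^ m)%R.
Proof.
  intros Hr; rewrite pow_add.
  assert (0 <= r ^ m)%R by now apply pow_le.
  assert (r ^ k <= 1)%R by (rewrite <- (pow1 k); apply pow_incr; lra).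
  nra.
Qed.

Lemma Cmod_pow_lt_1 (z : C) (n : nat) :
  (Cmod z < 1)%R -> (0 < n)%nat -> (Cmod (z ^ n) < 1)%R.
Proof.
  intros Hz Hn; rewrite Cmod_pow.
  apply pow_lt_1_compat; [split; [apply Cmod_ge_0|exact Hz]|exact Hn].
Qed.

(** * q-Pochhammer symbols *)

Lemma Cmod_term (a q : C) (k : nat) : Cmod (a * q ^ k) = (Cmod a * Cmod q ^ k)%R.
Proof. now rewrite Cmod_mult, Cmod_pow. Qed.

Lemma Cmod_one_minus_ge (z : C) : (1 - Cmod z <= Cmod (1 - z))%R.
Proof.
  pose proof (Cmod_triangle (1 - z) z) as H.
  replace (1 - z + z) with (RtoC 1) in H by ring.
  rewrite Cmod_1 in H; lra.
Qed.

Lemma Cmod_one_minus_le (z : C) : (Cmod (1 - z) <= 1 + Cmod z)%R.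
Proof.
  pose proof (Cmod_triangle 1 (- z)) as H.
  rewrite Cmod_1, Cmod_opp in H; exact H.
Qed.

Lemma exp_le (x y : R) : (x <= y)%R -> (exp x <= exp y)%R.
Proof.
  intros [H| ->]; [left; now apply exp_increasing|right; reflexivity].
Qed.

(** Each factor is at most [1 + |a| |q|^k <= exp (|a| |q|^k)], and the exponents
    have a convergent sum. *)
Lemma qpoch_bounded (a q : C) :
  (Cmod q < 1)%R ->
  exists M : R, (0 < M)%R /\ forall n, (Cmod (qpoch a q n) <= M)%R.
Proof.
  intros Hq. pose proof (Cmod_ge_0 a). pose proof (Cmod_ge_0 q).
  assert (Hs : forall n,
    (Cmod (qpoch a q (S n)) <= exp (Cmod a * sum_n (pow (Cmod q)) n))%R).
  { induction n as [|n IH].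
    - rewrite sum_O; simpl.
      rewrite Cmult_1_l.
      eapply Rle_trans; [apply Cmod_one_minus_le|].
      rewrite Cmult_1_r, Rmult_1_r; apply exp_ineq1_le.
    - change (qpoch a q (S (S n)))
        with (qpoch a q (S n) * (1 - a * q ^ S n)).
      rewrite sum_Sn, Cmod_mult; unfold plus; simpl (AbelianMonoid.plus _ _).
      rewrite Rmult_plus_distr_l, exp_plus.
      apply Rmult_le_compat; try apply Cmod_ge_0; [exact IH|].
      eapply Rle_trans; [apply Cmod_one_minus_le|].
      rewrite Cmod_term; apply exp_ineq1_le. }
  exists (exp (Cmod a * / (1 - Cmod q))); split; [apply exp_pos|].
  assert (Hinv : (0 < / (1 - Cmod q))%R) by (apply Rinv_0_lt_compat; lra).
  intros [|n].
  - change (qpoch a q 0) with (RtoC 1); rewrite Cmod_1.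
    rewrite <- exp_0 at 1; apply exp_le.
    apply Rmult_le_pos; lra.
  - eapply Rle_trans; [apply Hs|]; apply exp_le.
    apply Rmult_le_compat_l; [assumption|]; apply geometric_sum_le; lra.
Qed.

(** With [b = |a| / (1 - |a|)], each factor is at least
    [1 - |a| |q|^k >= exp (- b |q|^k)], and the exponents have a convergent sum. *)
Lemma qpoch_bounded_below (a q : C) :
  (Cmod a < 1)%R -> (Cmod q < 1)%R ->
  exists c : R, (0 < c)%R /\ forall n, (c <= Cmod (qpoch a q n))%R.
Proof.
  intros Ha Hq. pose proof (Cmod_ge_0 a). pose proof (Cmod_ge_0 q).
  set (b := (Cmod a / (1 - Cmod a))%R).
  assert (Hinva : (0 < / (1 - Cmod a))%R) by (apply Rinv_0_lt_compat; lra).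
  assert (Hb : (0 <= b)%R) by (apply Rmult_le_pos; lra).
  assert (Hterm : forall k, (exp (- (b * Cmod q ^ k)) <= Cmod (1 - a * q ^ k))%R).
  { intros k.
    eapply Rle_trans; [|apply Cmod_one_minus_ge].
    rewrite Cmod_term.
    assert (0 <= Cmod q ^ k)%R by (apply pow_le; lra).
    assert (Cmod q ^ k <= 1)%R.
    { rewrite <- (pow1 k); apply pow_incr; lra. }
    set (t := (Cmod q ^ k)%R) in *.
    assert (Ht : (1 + b * t <= exp (b * t))%R) by apply exp_ineq1_le.
    assert (Hbt : (0 <= b * t)%R) by (now apply Rmult_le_pos).
    (* (1 - |a| t) (1 + b t) - 1 = t (b - |a| - |a| b t) = t |a| b (1 - t),
       because b - |a| = |a| b. *)
    assert (Hprod : (1 <= (1 - Cmod a * t) * (1 + b * t))%R).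
    { assert (E : (b - Cmod a = Cmod a * b)%R) by (unfold b; field; lra).
      assert (0 <= t * (Cmod a * b * (1 - t)))%R.
      { repeat apply Rmult_le_pos; lra. }
      nra. }
    rewrite exp_Ropp.
    apply (Rmult_le_reg_r (1 + b * t)); [lra|].
    eapply Rle_trans; [|exact Hprod].
    eapply Rle_trans.
    - apply Rmult_le_compat_l; [left; apply Rinv_0_lt_compat, exp_pos|exact Ht].
    - right; apply Rinv_l; apply Rgt_not_eq, exp_pos. }
  assert (Hs : forall n,
    (exp (- (b * sum_n (pow (Cmod q)) n)) <= Cmod (qpoch a q (S n)))%R).
  { induction n as [|n IH].
    - rewrite sum_O; simpl qpoch; rewrite Cmult_1_l; apply (Hterm 0%nat).
    - change (qpoch a q (S (S n)))
        with (qpoch a q (S n) * (1 - a * q ^ S n)).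
      rewrite sum_Sn, Cmod_mult; unfold plus; simpl (AbelianMonoid.plus _ _).
      rewrite Rmult_plus_distr_l, Ropp_plus_distr, exp_plus.
      apply Rmult_le_compat; try (left; apply exp_pos); [exact IH|apply Hterm]. }
  exists (exp (- (b * / (1 - Cmod q)))); split; [apply exp_pos|].
  assert (Hinv : (0 < / (1 - Cmod q))%R) by (apply Rinv_0_lt_compat; lra).
  intros [|n].
  - change (qpoch a q 0) with (RtoC 1); rewrite Cmod_1.
    rewrite <- exp_0 at 2; apply exp_le.
    assert (0 <= b * / (1 - Cmod q))%R by (apply Rmult_le_pos; lra).
    lra.
  - eapply Rle_trans; [|apply Hs]; apply exp_le, Ropp_le_contravar.
    apply Rmult_le_compat_l; [assumption|]; apply geometric_sum_le; lra.
Qed.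

Lemma qpoch_neq_0 (a q : C) (n : nat) :
  (Cmod a < 1)%R -> (Cmod q < 1)%R -> qpoch a q n <> 0.
Proof.
  intros Ha Hq; destruct (qpoch_bounded_below a q Ha Hq) as [c [Hc H]].
  apply Cmod_gt_0; specialize (H n); lra.
Qed.

Lemma qpoch_sq (q : C) (n : nat) :
  qpoch (q ^ 2) (q ^ 2) n = qpoch q q n * qpoch (- q) q n.
Proof.
  induction n as [|n IH]; simpl; [ring|].
  replace (q * (q * 1)) with (q ^ 2) by (simpl; ring).
  rewrite IH, <- Cpow_mult_r, Nat.mul_comm, Cpow_mult_r; simpl; ring.
Qed.

(** * Nonvanishing of the alternating theta series *)

(** Truncation of the series in the q-binomial theorem, whose full sum is
    [(a z; q)_oo / (z; q)_oo]. *)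
Definition qbinomial_sum (a q z : C) (n : nat) : C :=
  sum_n (fun s => qpoch a q s / qpoch q q s * z ^ s) n.

(** The full series [F] satisfies [(1 - a z) F (q z) = (1 - z) F z]. On the term of
    index [s] the difference of the two sides is [B_(s+1) - B_s], where
    [B_s = (a;q)_s / (q;q)_(s-1) * z^s] and [B_0 = 0]; truncation therefore leaves
    [B_(n+1)]. *)
Lemma qbinomial_sum_shift (a q z : C) (n : nat) :
  (Cmod q < 1)%R ->
  (1 - a * z) * qbinomial_sum a q (q * z) n - (1 - z) * qbinomial_sum a q z n =
  qpoch a q (S n) / qpoch q q n * z ^ S n.
Proof.
  intros Hq; unfold qbinomial_sum.
  induction n as [|n IH].
  - rewrite !sum_O; simpl; field; discriminate.
  - rewrite !C_sum_Sn.
    rewrite !Cmult_plus_distr_l.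
    match type of IH with ?A - ?B = ?D =>
      match goal with |- A + ?E - (B + ?F) = ?G =>
        replace (A + E - (B + F)) with ((A - B) + (E - F)) by ring end end.
    rewrite IH.
    pose proof (qpoch_neq_0 q q (S n) Hq Hq) as Hn; simpl in Hn.
    rewrite Cpow_mult_l; simpl.
    field; split; intros H; apply Hn; rewrite H; ring.
Qed.

Lemma qpoch_m1_S (q : C) (n : nat) : qpoch (- (1)) q (S n) = 2 * qpoch (- q) q n.
Proof.
  induction n as [|n IH]; [simpl; ring|].
  change (qpoch (- (1)) q (S n) * (1 - - (1) * q ^ S n) = 2 * qpoch (- q) q (S n)).
  rewrite IH; simpl; ring.
Qed.

(** [n * n] and [n] have the same parity. *)
Lemma Cpow_opp_sq (x : C) (n : nat) : (- x) ^ (n * n) = (- (1)) ^ n * x ^ (n * n).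
Proof.
  replace (- x) with (- (1) * x) by ring.
  rewrite Cpow_mult_l; f_equal.
  assert (H : forall k, (- (1)) ^ (k * (k + 1)) = 1).
  { induction k as [|k IH]; [reflexivity|].
    replace (S k * (S k + 1))%nat with (k * (k + 1) + S k * 2)%nat by lia.
    rewrite Cpow_add_r, IH, (Nat.mul_comm (S k)), Cpow_mult_r.
    replace ((- (1)) ^ 2) with (RtoC 1) by (simpl; ring).
    rewrite Cpow_1_l; ring. }
  destruct n as [|n]; [reflexivity|].
  replace (S n * S n)%nat with (n * (n + 1) + S n)%nat by lia.
  rewrite Cpow_add_r, H; ring.
Qed.

(** Going from [n] to [n + 1] multiplies the argument of the truncated
    q-binomial series by [x], which [qbinomial_sum_shift] turns into an explicit
    correction; together with the new last term of the truncated series this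
    correction is exactly [2 * (- x) ^ ((n + 1) * (n + 1))]. *)
Lemma theta_partial_sum (x : C) (n : nat) :
  (Cmod x < 1)%R ->
  2 * sum_n (fun k => (- x) ^ (k * k)) n - 1 =
  qpoch x x n / qpoch (- x) x n * qbinomial_sum (- (1)) x (- x ^ S n) n.
Proof.
  intros Hx.
  assert (Hmx : (Cmod (- x) < 1)%R) by now rewrite Cmod_opp.
  induction n as [|n IH].
  - unfold qbinomial_sum; rewrite !sum_O; simpl; field; discriminate.
  - rewrite C_sum_Sn.
    transitivity ((2 * sum_n (fun k => (- x) ^ (k * k)) n - 1)
                  + 2 * (- x) ^ (S n * S n)); [ring|].
    rewrite IH, Cpow_opp_sq.
    pose proof (qbinomial_sum_shift (- (1)) x (- x ^ S n) n Hx) as E.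
    replace (x * - x ^ S n) with (- x ^ S (S n)) in E by (simpl; ring).
    unfold qbinomial_sum at 2; rewrite C_sum_Sn.
    fold (qbinomial_sum (- (1)) x (- x ^ S (S n)) n).
    rewrite !qpoch_m1_S in *.
    replace ((- x ^ S n) ^ S n) with ((- (1)) ^ S n * x ^ (S n * S n)) in E
      by (rewrite Cpow_mult_r, <- Cpow_mult_l; f_equal; ring).
    replace ((- x ^ S (S n)) ^ S n)
      with ((- (1)) ^ S n * (x ^ (S n * S n) * x ^ S n)).
    2:{ replace (- x ^ S (S n)) with (- (1) * (x ^ S n * x)) by (simpl; ring).
        now rewrite !Cpow_mult_l, <- Cpow_mult_r. }
    set (E1 := qbinomial_sum _ x (- x ^ S n) n) in *.
    set (E2 := qbinomial_sum _ x (- x ^ S (S n)) n) in *.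
    set (e := (- (1)) ^ S n * x ^ (S n * S n)) in *.
    replace ((- (1)) ^ S n * (x ^ (S n * S n) * x ^ S n)) with (e * x ^ S n)
      by (unfold e; ring).
    pose proof (qpoch_neq_0 x x (S n) Hx Hx) as H1.
    pose proof (qpoch_neq_0 (- x) x (S n) Hmx Hx) as H2.
    change (qpoch x x (S n)) with (qpoch x x n * (1 - x * x ^ n)) in *.
    change (qpoch (- x) x (S n)) with (qpoch (- x) x n * (1 - - x * x ^ n)) in *.
    change (x ^ S n) with (x * x ^ n) in *.
    set (y := x * x ^ n) in *.
    replace (- x * x ^ n) with (- y) in * by (unfold y; ring).
    set (u := qpoch x x n) in *. set (v := qpoch (- x) x n) in *.
    assert (Hu : u <> 0) by (intros H; apply H1; rewrite H; ring).
    assert (Hv : v <> 0) by (intros H; apply H2; rewrite H; ring).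
    assert (Hym : 1 - y <> 0) by (intros H; apply H1; rewrite H; ring).
    assert (Hyp : 1 - - y <> 0) by (intros H; apply H2; rewrite H; ring).
    assert (E2' : E2 = ((1 + y) * E1 + 2 * v / u * e) / (1 - y)).
    { replace (2 * v / u * e) with ((1 - - (1) * - y) * E2 - (1 - - y) * E1)
        by exact E.
      field; exact Hym. }
    rewrite E2'. field. repeat split; assumption.
Qed.

Lemma qbinomial_sum_near_1 (a q z : C) (M : R) (n : nat) :
  (forall s, Cmod (qpoch a q s / qpoch q q s) <= M)%R -> (Cmod z < 1)%R ->
  (Cmod (qbinomial_sum a q z n - 1) <= M * (Cmod z / (1 - Cmod z)))%R.
Proof.
  intros HM Hz. pose proof (Cmod_ge_0 z) as Hz0.
  assert (HM0 : (0 <= M)%R) by (eapply Rle_trans; [apply Cmod_ge_0|apply (HM 0%nat)]).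
  assert (Hind : (Cmod (qbinomial_sum a q z n - 1)
                  <= M * (Cmod z * (1 - Cmod z ^ n) / (1 - Cmod z)))%R).
  { unfold qbinomial_sum; induction n as [|n IH].
    - rewrite sum_O; simpl.
      replace (1 / 1 * 1 - 1) with (RtoC 0) by (field; discriminate).
      rewrite Cmod_0; right; field; lra.
    - rewrite C_sum_Sn.
      match goal with |- Rle (Cmod (?A + ?B - ?c)) _ =>
        replace (A + B - c) with ((A - c) + B) by ring end.
      eapply Rle_trans; [apply Cmod_triangle|].
      eapply Rle_trans; [apply Rplus_le_compat; [exact IH|]|].
      + rewrite Cmod_mult, Cmod_pow.
        apply Rmult_le_compat_r; [apply pow_le; exact Hz0|apply HM].
      + right; simpl; field; lra. }
  eapply Rle_trans; [exact Hind|].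
  apply Rmult_le_compat_l; [exact HM0|].
  assert (0 < / (1 - Cmod z))%R by (apply Rinv_0_lt_compat; lra).
  assert (0 <= Cmod z ^ n)%R by (apply pow_le; lra).
  apply Rmult_le_compat_r; nra.
Qed.

(** The series is one-sided, so [2 * l - 1] is the sum over all integers. *)
Lemma theta_series_neq_0 (x l : C) :
  (Cmod x < 1)%R -> is_series (fun k => (- x) ^ (k * k)) l -> 2 * l - 1 <> 0.
Proof.
  intros Hx Hl Hzero.
  destruct (qpoch_bounded_below x x Hx Hx) as [c1 [Hc1 Hlow]].
  destruct (qpoch_bounded (- x) x Hx) as [M1 [HM1 Hup1]].
  destruct (qpoch_bounded (- (1)) x Hx) as [M2 [HM2 Hup2]].
  assert (Hmx : (Cmod (- x) < 1)%R) by now rewrite Cmod_opp.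
  set (M := (M2 * / c1)%R). set (c := (c1 * / M1)%R).
  assert (Hic1 : (0 < / c1)%R) by now apply Rinv_0_lt_compat.
  assert (HiM1 : (0 < / M1)%R) by now apply Rinv_0_lt_compat.
  assert (HM : (0 < M)%R) by now apply Rmult_lt_0_compat.
  assert (Hc : (0 < c)%R) by now apply Rmult_lt_0_compat.
  assert (Hcoef : forall s, (Cmod (qpoch (- (1)) x s / qpoch x x s) <= M)%R).
  { intros s; rewrite Cmod_div by now apply qpoch_neq_0.
    apply Rmult_le_compat; [apply Cmod_ge_0| |apply Hup2|].
    - left; apply Rinv_0_lt_compat; specialize (Hlow s); lra.
    - apply Rinv_le_contravar; [exact Hc1|apply Hlow]. }
  assert (HP : forall n, (c <= Cmod (qpoch x x n / qpoch (- x) x n))%R).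
  { intros n; assert (Hn : qpoch (- x) x n <> 0) by now apply qpoch_neq_0.
    rewrite Cmod_div by exact Hn.
    apply Rmult_le_compat; [lra|lra|apply Hlow|].
    apply Rinv_le_contravar; [now apply Cmod_gt_0|apply Hup1]. }
  (* The two-sided partial sums have modulus at least c / 2 for large n; were
     the sum 0, they would end up below 2 * (c / 8). *)
  destruct (proj1 (C_is_series_iff _ _) Hl (c / 8)%R ltac:(lra)) as [N1 HN1].
  (* A bound on |x^(n+1)| that makes the q-binomial factor at least 1/2 in modulus. *)
  set (d := (/ (4 * (M + 1)))%R).
  assert (Hd : (0 < d)%R) by (apply Rinv_0_lt_compat; lra).
  assert (Hd1 : (4 * d + 4 * (M * d) = 1)%R) by (unfold d; field; lra).
  assert (Hx' : (Rabs (Cmod x) < 1)%R)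
    by (rewrite Rabs_pos_eq; [exact Hx|apply Cmod_ge_0]).
  destruct (pow_lt_1_zero _ Hx' d Hd) as [N2 HN2].
  set (n := Nat.max N1 N2).
  specialize (HN1 n ltac:(lia)). specialize (HN2 (S n) ltac:(lia)).
  set (z := - x ^ S n).
  assert (Hz : (Cmod z < d)%R).
  { unfold z; rewrite Cmod_opp, Cmod_pow.
    rewrite Rabs_pos_eq in HN2; [exact HN2|apply pow_le, Cmod_ge_0]. }
  pose proof (Cmod_ge_0 z) as Hz0.
  assert (HMd : (0 < M * d)%R) by now apply Rmult_lt_0_compat.
  assert (Hz1 : (Cmod z < 1)%R) by lra.
  pose proof (qbinomial_sum_near_1 (- (1)) x z M n Hcoef Hz1) as Hnear.
  assert (Hhalf : (M * (Cmod z / (1 - Cmod z)) <= / 2)%R).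
  { assert (0 < 1 - Cmod z)%R by lra.
    apply (Rmult_le_reg_r (1 - Cmod z)); [assumption|].
    replace (M * (Cmod z / (1 - Cmod z)) * (1 - Cmod z))%R
      with (M * Cmod z)%R by (field; lra).
    assert (M * Cmod z <= M * d)%R by (apply Rmult_le_compat_l; lra).
    lra. }
  set (Q := qbinomial_sum (- (1)) x z n) in *.
  assert (HQ : (/ 2 <= Cmod Q)%R).
  { pose proof (Cmod_one_minus_ge (1 - Q)) as H.
    replace (1 - (1 - Q)) with Q in H by ring.
    rewrite <- (Cmod_opp (1 - Q)) in H.
    replace (- (1 - Q)) with (Q - 1) in H by ring.
    lra. }
  pose proof (theta_partial_sum x n Hx) as E.
  fold z in E. fold Q in E.
  assert (Hge : (c * / 2 <= Cmod (2 * sum_n (fun k => (- x) ^ (k * k))%C n - 1))%R).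
  { rewrite E, Cmod_mult; apply Rmult_le_compat; [lra|lra|apply HP|exact HQ]. }
  assert (E2 : 2 * sum_n (fun k => (- x) ^ (k * k)) n - 1 =
               2 * (sum_n (fun k => (- x) ^ (k * k)) n - l)).
  { transitivity (2 * (sum_n (fun k => (- x) ^ (k * k)) n - l) + (2 * l - 1));
      [ring|rewrite Hzero; ring]. }
  rewrite E2, Cmod_mult, Cmod_R, Rabs_pos_eq in Hge by lra.
  lra.
Qed.

(** * The diagonal of Ramanujan's theta function *)

(** Both halved products are nonnegative, and [n(n+1)/2 + n(n-1)/2 = n^2]. *)
Lemma theta_exponent (n : Z) :
  (Z.to_nat (n * (n + 1) / 2) + Z.to_nat (n * (n - 1) / 2))%nat =
  (Z.abs_nat n * Z.abs_nat n)%nat.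
Proof.
  destruct (Z.Even_or_Odd n) as [[k ->]|[k ->]].
  - replace (2 * k * (2 * k + 1))%Z with (k * (2 * k + 1) * 2)%Z by ring.
    replace (2 * k * (2 * k - 1))%Z with (k * (2 * k - 1) * 2)%Z by ring.
    rewrite !Z.div_mul by lia. nia.
  - replace ((2 * k + 1) * (2 * k + 1 + 1))%Z
      with ((2 * k + 1) * (k + 1) * 2)%Z by ring.
    replace ((2 * k + 1) * (2 * k + 1 - 1))%Z
      with ((2 * k + 1) * k * 2)%Z by ring.
    rewrite !Z.div_mul by lia. nia.
Qed.

(** The terms of index [n] and [- n] are both [a ^ (n * n)], so the two halves of
    the bilateral series sum to [l] and [l - 1]. *)
Lemma ramanujan_f_diagonal (a : C) :
  (Cmod a < 1)%R ->
  exists l : C, is_series (fun k => a ^ (k * k)) l /\ ramanujan_f a a = 2 * l - 1.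
Proof.
  intros Ha. pose proof (Cmod_ge_0 a) as Ha0.
  assert (Hex : exists l : C, is_series (fun k => a ^ (k * k)) l).
  { apply (ex_series_le (V := C_CompleteNormedModule) _ (pow (Cmod a))).
    - intros k. change (Cmod (a ^ (k * k)) <= Cmod a ^ k)%R. rewrite Cmod_pow.
      destruct k as [|k]; [right; reflexivity|].
      replace (S k * S k)%nat with (S k + k * S k)%nat by lia.
      apply pow_add_le; lra.
    - apply ex_series_geom; rewrite Rabs_pos_eq; assumption. }
  destruct Hex as [l Hl]; exists l; split; [exact Hl|].
  assert (Hterm : forall n : Z,
    a ^ Z.to_nat (n * (n + 1) / 2) * a ^ Z.to_nat (n * (n - 1) / 2) =
    a ^ (Z.abs_nat n * Z.abs_nat n)).
  { intros n; rewrite <- Cpow_add_r; f_equal; apply theta_exponent. }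
  assert (Hpos : is_series (V := C_NormedModule) (fun n : nat =>
    a ^ Z.to_nat (Z.of_nat n * (Z.of_nat n + 1) / 2) *
    a ^ Z.to_nat (Z.of_nat n * (Z.of_nat n - 1) / 2)) l).
  { eapply is_series_ext; [|exact Hl].
    intros n; rewrite Hterm, Zabs2Nat.id; reflexivity. }
  assert (Hneg : is_series (V := C_NormedModule) (fun n : nat =>
    a ^ Z.to_nat (- Z.of_nat (S n) * (- Z.of_nat (S n) + 1) / 2) *
    a ^ Z.to_nat (- Z.of_nat (S n) * (- Z.of_nat (S n) - 1) / 2)) (l - 1)).
  { eapply is_series_ext.
    2:{ apply (is_series_incr_1 (V := C_NormedModule) (fun k => a ^ (k * k)) (l - 1)).
        match goal with |- is_series _ ?r => replace r with l; [exact Hl|] end.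
        change (l = l - 1 + 1); ring. }
    intros n; cbv beta; rewrite Hterm.
    now replace (Z.abs_nat (- Z.of_nat (S n))) with (S n) by lia. }
  apply (iota_unique (V := C_CompleteNormedModule)).
  - intros y [l1 [l2 [H1 [H2 ->]]]].
    rewrite (filterlim_locally_unique _ _ _ H1 Hpos).
    rewrite (filterlim_locally_unique _ _ _ H2 Hneg).
    change (@eq C (l + (l - 1)) (2 * l - 1)); ring.
  - exists l, (l - 1); repeat split; [exact Hpos|exact Hneg|ring].
Qed.

(** * Summation by telescoping *)

Lemma summand_telescopes (q : C) (n : nat) :
  (Cmod q < 1)%R ->
  q ^ (n * (n + 1)) * qpoch (q ^ 2) (q ^ 2) (n + 1) /
    (qpoch (- q ^ 3) (q ^ 3) (n + 1) * qpoch q q n) =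
  q ^ (n * (n + 1)) * qpoch (- q) q n / qpoch (- q ^ 3) (q ^ 3) n -
  q ^ (S n * (S n + 1)) * qpoch (- q) q (S n) / qpoch (- q ^ 3) (q ^ 3) (S n).
Proof.
  intros Hq.
  assert (Hq3 : (Cmod (q ^ 3) < 1)%R).
  { apply Cmod_pow_lt_1; [exact Hq|lia]. }
  assert (Hmq3 : (Cmod (- q ^ 3) < 1)%R) by now rewrite Cmod_opp.
  pose proof (qpoch_neq_0 _ _ n Hq Hq) as H1.
  pose proof (qpoch_neq_0 _ _ (S n) Hmq3 Hq3) as H2.
  rewrite Nat.add_1_r, qpoch_sq.
  replace (S n * (S n + 1))%nat with (n * S n + S n * 2)%nat by lia.
  rewrite Cpow_add_r, (Cpow_mult_r q (S n) 2).
  change (qpoch q q (S n)) with (qpoch q q n * (1 - q * q ^ n)).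
  change (qpoch (- q) q (S n)) with (qpoch (- q) q n * (1 - - q * q ^ n)).
  change (qpoch (- q ^ 3) (q ^ 3) (S n))
    with (qpoch (- q ^ 3) (q ^ 3) n * (1 - - q ^ 3 * (q ^ 3) ^ n)) in *.
  change (q ^ S n) with (q * q ^ n).
  assert (E3 : - q ^ 3 * (q ^ 3) ^ n = - (q * q ^ n) ^ 3).
  { rewrite Cpow_mult_l, <- !Cpow_mult_r, (Nat.mul_comm n); ring. }
  rewrite E3 in *.
  replace (- q * q ^ n) with (- (q * q ^ n)) by ring.
  set (y := q * q ^ n) in *.
  set (w := qpoch (- q ^ 3) (q ^ 3) n) in *.
  assert (Hw : w <> 0) by (intros H; apply H2; rewrite H; ring).
  assert (Hy : 1 - - y ^ 3 <> 0) by (intros H; apply H2; rewrite H; ring).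
  field. repeat split; assumption.
Qed.

Lemma telescoped_sum (q : C) :
  (Cmod q < 1)%R ->
  is_series
    (fun n : nat =>
       q ^ (n * (n + 1)) * qpoch (q ^ 2) (q ^ 2) (n + 1) /
       (qpoch (- q ^ 3) (q ^ 3) (n + 1) * qpoch q q n)) (RtoC 1).
Proof.
  intros Hq. pose proof (Cmod_ge_0 q) as Hq0.
  set (U := fun n : nat =>
    q ^ (n * (n + 1)) * qpoch (- q) q n / qpoch (- q ^ 3) (q ^ 3) n).
  assert (Hq3 : (Cmod (q ^ 3) < 1)%R).
  { apply Cmod_pow_lt_1; [exact Hq|lia]. }
  assert (Hmq3 : (Cmod (- q ^ 3) < 1)%R) by now rewrite Cmod_opp.
  destruct (qpoch_bounded (- q) q Hq) as [M [HM Hup]].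
  destruct (qpoch_bounded_below _ _ Hmq3 Hq3) as [c [Hc Hlow]].
  assert (Hic : (0 < / c)%R) by now apply Rinv_0_lt_compat.
  assert (HMc : (0 < M * / c)%R) by now apply Rmult_lt_0_compat.
  assert (HU : forall n, (Cmod (U n) <= Cmod q ^ n * (M * / c))%R).
  { intros n; unfold U.
    rewrite Cmod_div, Cmod_mult, Cmod_pow by now apply qpoch_neq_0.
    unfold Rdiv; rewrite Rmult_assoc.
    assert (0 <= / Cmod (qpoch (- q ^ 3) (q ^ 3) n))%R.
    { left; apply Rinv_0_lt_compat; specialize (Hlow n); lra. }
    apply Rmult_le_compat.
    - now apply pow_le.
    - apply Rmult_le_pos; [apply Cmod_ge_0|assumption].
    - replace (n * (n + 1))%nat with (n + n * n)%nat by lia.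
      apply pow_add_le; lra.
    - apply Rmult_le_compat; [apply Cmod_ge_0|assumption|apply Hup|].
      apply Rinv_le_contravar; [exact Hc|apply Hlow]. }
  apply C_is_series_iff; intros eps Heps.
  assert (Hq' : (Rabs (Cmod q) < 1)%R) by (rewrite Rabs_pos_eq; assumption).
  assert (Hd : (0 < eps / (M * / c))%R) by (apply Rdiv_lt_0_compat; assumption).
  destruct (pow_lt_1_zero _ Hq' _ Hd) as [N HN].
  exists N; intros n Hn.
  match goal with |- (Cmod (sum_n ?t n - _) < _)%R =>
    assert (Hsum : sum_n t n = 1 - U (S n)) end.
  { clear Hn; induction n as [|n IH].
    - rewrite sum_O, summand_telescopes by exact Hq.
      change (U 0%nat - U 1%nat = 1 - U 1%nat); f_equal.
      unfold U; simpl; field; discriminate.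
    - rewrite C_sum_Sn, IH, summand_telescopes by exact Hq.
      change (@eq C (1 - U (S n) + (U (S n) - U (S (S n)))) (1 - U (S (S n)))).
      ring. }
  rewrite Hsum.
  replace (1 - U (S n) - 1) with (- U (S n)) by ring.
  rewrite Cmod_opp.
  eapply Rle_lt_trans; [apply HU|].
  specialize (HN (S n) ltac:(lia)).
  rewrite Rabs_pos_eq in HN by now apply pow_le.
  apply (Rmult_lt_compat_r (M * / c)) in HN; [|exact HMc].
  replace (eps / (M * / c) * (M * / c))%R with eps in HN by (field; lra).
  exact HN.
Qed.

Theorem mainTheorem3 : forall q : C, (Cmod q < 1)%R ->
  is_series
    (fun n : nat =>
       q ^ (n * (n + 1)) * qpoch (q ^ 2) (q ^ 2) (n + 1) /
       (qpoch (- q ^ 3) (q ^ 3) (n + 1) * qpoch q q n))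
    (ramanujan_f (- q ^ 2) (- q ^ 2) / ramanujan_phi (- q ^ 2)) /\
  ramanujan_f (- q ^ 2) (- q ^ 2) / ramanujan_phi (- q ^ 2) = 1.
Proof.
  intros q Hq.
  assert (Hq2 : (Cmod (q ^ 2) < 1)%R).
  { apply Cmod_pow_lt_1; [exact Hq|lia]. }
  assert (E : ramanujan_f (- q ^ 2) (- q ^ 2) / ramanujan_phi (- q ^ 2) = 1).
  { unfold ramanujan_phi.
    destruct (ramanujan_f_diagonal (- q ^ 2)) as [l [Hl ->]].
    - now rewrite Cmod_opp.
    - field; exact (theta_series_neq_0 _ _ Hq2 Hl). }
  split; [rewrite E; now apply telescoped_sum|exact E].
Qed.
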